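(* Let $x,y,z,w$ be distinct variables. The sequent $$((x/y)\vee w)\,/\,((x/y)\vee(x/z)\vee w),\;\; (x/y)\vee w,\;\; ((x/y)\vee w)\backslash((x/z)\vee w)\;\vdash\;(x/(y\vee z))\vee w$$ is derivable in $\mathbf{MALC}+\mathcal{D}$, but it is not derivable in $\mathbf{IAL}$.
   Context: Formulae are built from variables by the binary connectives $\cdot,\backslash,/,\wedge,\vee$ (an unbracketed $X\vee Y\vee Z$ means $(X\vee Y)\vee Z$). A sequent is $\Gamma\vdash C$, where $\Gamma$ is a finite sequence of formulae and $C$ is a formula. The calculus $\mathbf{MALC}^{*}$ has axioms $A\vdash A$ and the following rules (premises before $\Rightarrow$, conclusion after): - $(\backslash L)$: $\Pi\vdash A$ and $\Gamma,B,\Delta\vdash C$ $\Rightarrow$ $\Gamma,\Pi,A\backslash B,\Delta\vdash C$; $(\backslash R)$: $A,\Pi\vdash B$ $\Rightarrow$ $\Pi\vdash A\backslash B$; - $(/L)$: $\Pi\vdash A$ and $\Gamma,B,\Delta\vdash C$ $\Rightarrow$ $\Gamma,B/A,\Pi,\Delta\vdash C$; $(/R)$: $\Pi,A\vdash B$ $\Rightarrow$ $\Pi\vdash B/A$; - $(\cdot L)$: $\Gamma,A,B,\Delta\vdash C$ $\Rightarrow$ $\Gamma,A\cdot B,\Delta\vdash C$; $(\cdot R)$: $\Gamma\vdash A$ and $\Delta\vdash B$ $\Rightarrow$ $\Gamma,\Delta\vdash A\cdot B$; - $(\vee L)$: $\Gamma,A,\Delta\vdash C$ and $\Gamma,B,\Delta\vdash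 C$ $\Rightarrow$ $\Gamma,A\vee B,\Delta\vdash C$; $(\vee R)$: $\Pi\vdash A$ $\Rightarrow$ $\Pi\vdash A\vee B$, and $\Pi\vdash B$ $\Rightarrow$ $\Pi\vdash A\vee B$; - $(\wedge L)$: $\Gamma,A,\Delta\vdash C$ $\Rightarrow$ $\Gamma,A\wedge B,\Delta\vdash C$, and $\Gamma,B,\Delta\vdash C$ $\Rightarrow$ $\Gamma,A\wedge B,\Delta\vdash C$; $(\wedge R)$: $\Pi\vdash A$ and $\Pi\vdash B$ $\Rightarrow$ $\Pi\vdash A\wedge B$; - (Cut): $\Pi\vdash A$ and $\Gamma,A,\Delta\vdash C$ $\Rightarrow$ $\Gamma,\Pi,\Delta\vdash C$. $\mathbf{MALC}$ is the same calculus with the restriction that $\Pi$ is non-empty in $(\backslash R)$ and $(/R)$ (so all antecedents are non-empty). $\mathbf{MALC}+\mathcal{D}$ is $\mathbf{MALC}$ (including cut) with the extra axiom scheme $(A\vee C)\wedge(B\vee C)\vdash(A\wedge B)\vee C$. $\mathbf{IAL}$ (intuitionistic affine logic) is obtained from $\mathbf{MALC}^{*}$ by adding the structural rules of permutation, $\Gamma,B,A,\Delta\vdash C$ $\Rightarrow$ $\Gamma,A,B,\Delta\vdash C$, and weakening, $\Gamma,\Delta\vdash C$ $\Rightarrow$ $\Gamma,A,\Delta\vdash C$. (In $\mathbf{IAL}$ the formulae $A\backslash B$ and $B/A$ are equivalent and are both commonly written $A\multimap B$.) *)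

(* Defs.v *)
From Stdlib Require Import List.
Import ListNotations.

Set Implicit Arguments.

(* [V] is the set of variables.  [Under A B] is "A under B" (A \ B) and
   [Over B A] is "B over A" (B / A), so that the denominator is [A] in both. *)
Inductive formula (V : Type) : Type :=
| Var : V -> formula V
| Prod : formula V -> formula V -> formula V
| Under : formula V -> formula V -> formula V
| Over : formula V -> formula V -> formula V
| Meet : formula V -> formula V -> formula V
| Join : formula V -> formula V -> formula V.

Declare Scope formula_scope.
Delimit Scope formula_scope with F.
Bind Scope formula_scope with formula.

Notation "A · B" := (Prod A B) (at level 40, left associativity) : formula_scope.
Notation "A \ B" := (Under A B) (at level 40, left associativity) : formula_scope.
Notation "B / A" := (Over B A) (at level 40, left associativity) : formula_scope.
Notation "A ∧ B" := (Meet A B) (at level 50, left associativity) : formula_scope.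
Notation "A ∨ B" := (Join A B) (at level 50, left associativity) : formula_scope.

(* The ways in which the calculi below differ from one another. *)
Record calculus (V : Type) : Type := Calculus {
  (* the antecedent of the conclusion of (\R) and (/R) must be non-empty *)
  lambek_restriction : Prop;
  permutation_rule : Prop;
  weakening_rule : Prop;
  extra_axiom : list (formula V) -> formula V -> Prop
}.

Section Derivability.

Variables (V : Type) (K : calculus V).

Reserved Notation "G ⊢ C" (at level 70, no associativity).

Inductive derivable : list (formula V) -> formula V -> Prop :=
| d_ax A : [A] ⊢ A
| d_underL P G D A B C :
    P ⊢ A -> G ++ [B] ++ D ⊢ C -> G ++ P ++ [A \ B]%F ++ D ⊢ C
| d_underR P A B :
    (lambek_restriction K -> P <> []) -> [A] ++ P ⊢ B -> P ⊢ A \ B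
| d_overL P G D A B C :
    P ⊢ A -> G ++ [B] ++ D ⊢ C -> G ++ [B / A]%F ++ P ++ D ⊢ C
| d_overR P A B :
    (lambek_restriction K -> P <> []) -> P ++ [A] ⊢ B -> P ⊢ B / A
| d_prodL G D A B C : G ++ [A; B] ++ D ⊢ C -> G ++ [A · B]%F ++ D ⊢ C
| d_prodR G D A B : G ⊢ A -> D ⊢ B -> G ++ D ⊢ A · B
| d_joinL G D A B C :
    G ++ [A] ++ D ⊢ C -> G ++ [B] ++ D ⊢ C -> G ++ [A ∨ B]%F ++ D ⊢ C
| d_joinR1 P A B : P ⊢ A -> P ⊢ A ∨ B
| d_joinR2 P A B : P ⊢ B -> P ⊢ A ∨ B
| d_meetL1 G D A B C : G ++ [A] ++ D ⊢ C -> G ++ [A ∧ B]%F ++ D ⊢ C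
| d_meetL2 G D A B C : G ++ [B] ++ D ⊢ C -> G ++ [A ∧ B]%F ++ D ⊢ C
| d_meetR P A B : P ⊢ A -> P ⊢ B -> P ⊢ A ∧ B
| d_cut P G D A C : P ⊢ A -> G ++ [A] ++ D ⊢ C -> G ++ P ++ D ⊢ C
| d_perm G D A B C :
    permutation_rule K -> G ++ [B; A] ++ D ⊢ C -> G ++ [A; B] ++ D ⊢ C
| d_weak G D A C :
    weakening_rule K -> G ++ D ⊢ C -> G ++ [A] ++ D ⊢ C
| d_extra G C : extra_axiom K G C -> G ⊢ C
where "G ⊢ C" := (derivable G C%F).

End Derivability.

Definition no_axiom (V : Type) : list (formula V) -> formula V -> Prop :=
  fun _ _ => False.

Inductive distributivity_axiom (V : Type) :
  list (formula V) -> formula V -> Prop :=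
| distributivity A B C :
    distributivity_axiom [(A ∨ C) ∧ (B ∨ C)]%F ((A ∧ B) ∨ C)%F.

Definition MALC_star (V : Type) : calculus V :=
  Calculus False False False (@no_axiom V).

Definition MALC (V : Type) : calculus V :=
  Calculus True False False (@no_axiom V).

Definition MALC_D (V : Type) : calculus V :=
  Calculus True False False (@distributivity_axiom V).

Definition IAL (V : Type) : calculus V :=
  Calculus False True True (@no_axiom V).

(* Main.v *)
Require Import Defs.
From Stdlib Require Import List ZArith Ring Lia.
Import ListNotations.

(** Derivability: writing [A = x / y] and [B = x / z], the antecedent entails both
    [A ∨ w] and [B ∨ w], since each of them entails [A ∨ B ∨ w]; by
    distributivity it entails [(A ∧ B) ∨ w], and [A ∧ B] entails [x / (y ∨ z)].

    Underivability: the ideals of a commutative ring form a model of IAL, with sum as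
    join, intersection as meet and ideal quotient as division.  Such a lattice
    need not be distributive.  In [Z[s] / (s^2 - 2 s)] put [t = 2 - s], so that
    [s t = 0], and let [x = 0], [y = (t)], [z = (s)], [w = (2)].  Then
    [x / y = (s)] and [x / z = (t)], so [x / y ∨ w = x / z ∨ w = (s, 2)] and the
    first and last formulae of the antecedent denote the whole ring.  As
    [x / (y ∨ z) = (s) ∩ (t) = 0], the succedent denotes [(2)], which does not
    contain [s]. *)

(** * Derivation in [MALC_D] *)

Section Derivations.

Variable V : Type.
Implicit Types A B C W : formula V.

Lemma over_meet_over_join (K : calculus V) A B C :
  derivable K [A / B ∧ A / C]%F (A / (B ∨ C))%F.
Proof.
apply d_overR; [discriminate|].
apply (@d_joinL _ K [(A / B ∧ A / C)%F] []).
- apply (@d_meetL1 _ K [] [B]), (@d_overL _ K [B] [] []); apply d_ax.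
- apply (@d_meetL2 _ K [] [C]), (@d_overL _ K [C] [] []); apply d_ax.
Qed.

Lemma join_monotone_left (K : calculus V) A B W :
  derivable K [A] B -> derivable K [A ∨ W]%F (B ∨ W)%F.
Proof.
intros AB; apply (@d_joinL _ K [] []).
- now apply d_joinR1.
- apply d_joinR2, d_ax.
Qed.

(** The two outer formulae can be applied to the middle one in either order, and the order decides
    which conjunct [A ∨ W] or [B ∨ W] comes out. *)
Lemma guarded_distributivity A B W :
  derivable (MALC_D V)
    [(A ∨ W) / (A ∨ B ∨ W); A ∨ W; (A ∨ W) \ (B ∨ W)]%F (A ∧ B ∨ W)%F.
Proof.
set (K := MALC_D V).
assert (AW : derivable K [A ∨ W]%F (A ∨ B ∨ W)%F)
  by (apply join_monotone_left, d_joinR1, d_ax).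
assert (BW : derivable K [B ∨ W]%F (A ∨ B ∨ W)%F)
  by (apply join_monotone_left, d_joinR2, d_ax).
apply (@d_cut _ K [_; _; _] [] [] ((A ∨ W) ∧ (B ∨ W))%F);
  [|apply d_extra, distributivity].
apply d_meetR.
(* [A ∨ W]: the right formula acts first and gives [B ∨ W], which [BW] turns into the denominator of
   the left one. *)
- apply (@d_overL _ K [(A ∨ W)%F; ((A ∨ W) \ (B ∨ W))%F] [] []); [|apply d_ax].
  now apply (@d_underL _ K [(A ∨ W)%F] [] []); [apply d_ax|].
(* [B ∨ W]: the left formula acts first, its denominator being reached through [AW], and returns
   [A ∨ W] to the right one. *)
- apply (@d_underL _ K [((A ∨ W) / (A ∨ B ∨ W))%F; (A ∨ W)%F] [] []);
    [|apply d_ax].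
  now apply (@d_overL _ K [(A ∨ W)%F] [] []); [|apply d_ax].
Qed.

End Derivations.

(** * Soundness of [IAL] in the ideals of a commutative ring *)

Section IdealSemantics.

Variables (R : Type) (zero one : R) (add mul sub : R -> R -> R) (opp : R -> R).
Hypothesis Rth : ring_theory zero one add mul sub opp eq.
Add Ring Rring : Rth.

Local Infix "+" := add.
Local Infix "*" := mul.

Definition is_ideal (I : R -> Prop) : Prop :=
  I zero /\ (forall a b, I a -> I b -> I (a + b)) /\
  (forall r a, I a -> I (r * a)).

Variables (V : Type) (val : V -> R -> Prop).
Hypothesis val_ideal : forall v, is_ideal (val v).

(** The product is the generated ideal, written as an intersection of ideals so that no finite sums
    appear. Both divisions share one clause because the ring is commutative. *)
Fixpoint den (A : formula V) : R -> Prop :=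
  match A with
  | Var v => val v
  | Prod A B => fun r => forall J, is_ideal J ->
      (forall a b, den A a -> den B b -> J (a * b)) -> J r
  | Under A B | Over B A => fun r => forall a, den A a -> den B (r * a)
  | Meet A B => fun r => den A r /\ den B r
  | Join A B => fun r => exists a b, den A a /\ den B b /\ r = a + b
  end.

Lemma den_ideal (A : formula V) : is_ideal (den A).
Proof.
induction A as [v|A IA B IB|A IA B IB|B IB A IA|A IA B IB|A IA B IB]; simpl;
  [apply val_ideal| | | | |];
  destruct IA as (A0 & Aadd & Amul), IB as (B0 & Badd & Bmul);
  (split; [|split]).
- now intros J [J0 _] _.
- intros p q Hp Hq J HJ HAB.
  destruct (HJ) as (_ & Jadd & _); apply Jadd; [apply (Hp J)|apply (Hq J)]; auto.
- intros r p Hp J HJ HAB.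
  destruct (HJ) as (_ & _ & Jmul); apply Jmul, (Hp J); auto.
- intros a _; replace (zero * a) with zero by ring; exact B0.
- intros p q Hp Hq a Ha; replace ((p + q) * a) with (p * a + q * a) by ring; auto.
- intros r p Hp a Ha; replace (r * p * a) with (r * (p * a)) by ring; auto.
- intros a _; replace (zero * a) with zero by ring; exact B0.
- intros p q Hp Hq a Ha; replace ((p + q) * a) with (p * a + q * a) by ring; auto.
- intros r p Hp a Ha; replace (r * p * a) with (r * (p * a)) by ring; auto.
- auto.
- intros p q [] []; auto.
- intros r p []; auto.
- exists zero, zero; repeat split; auto; ring.
- intros p q (a & b & Ha & Hb & ->) (a' & b' & Ha' & Hb' & ->).
  exists (a + a'), (b + b'); repeat split; auto; ring.
- intros r p (a & b & Ha & Hb & ->).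
  exists (r * a), (r * b); repeat split; auto; ring.
Qed.

(** Only the products of elements are collected, not their sums: an ideal that contains these
    products contains the ideal they generate. *)
Fixpoint den_list (G : list (formula V)) : R -> Prop :=
  match G with
  | [] => fun p => p = one
  | A :: G => fun p => exists a q, den A a /\ den_list G q /\ p = a * q
  end.

Lemma den_list_app (G D : list (formula V)) (p : R) :
  den_list (G ++ D) p <->
  exists g d, den_list G g /\ den_list D d /\ p = g * d.
Proof.
revert p; induction G as [|A G IH]; intros p; simpl.
- split.
  + intros Hp; exists one, p; repeat split; auto; ring.
  + intros (g & d & -> & Hd & ->); now replace (one * d) with d by ring.
- split.
  + intros (a & q & Ha & Hq & ->); apply IH in Hq.
    destruct Hq as (g & d & Hg & Hd & ->).
    exists (a * g), d; repeat split; [|assumption|ring].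
    now exists a, g.
  + intros (g & d & (a & q & Ha & Hq & ->) & Hd & ->).
    exists a, (q * d); repeat split; [assumption| |ring].
    apply IH; now exists q, d.
Qed.

Lemma den_list_singleton (A : formula V) (p : R) : den_list [A] p <-> den A p.
Proof.
simpl; split.
- intros (a & q & Ha & -> & ->); now replace (a * one) with a by ring.
- intros Hp; exists p, one; repeat split; auto; ring.
Qed.

Lemma den_list_middle (G P D : list (formula V)) (p : R) :
  den_list (G ++ P ++ D) p <->
  exists g q d,
    den_list G g /\ den_list P q /\ den_list D d /\ p = g * (q * d).
Proof.
rewrite den_list_app; split.
- intros (g & p' & Hg & Hp' & ->); apply den_list_app in Hp'.
  destruct Hp' as (q & d & Hq & Hd & ->); now exists g, q, d.
- intros (g & q & d & Hg & Hq & Hd & ->); exists g, (q * d); split; auto.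
  split; auto; apply den_list_app; now exists q, d.
Qed.

Lemma den_list_middle_singleton (G D : list (formula V)) (A : formula V)
    (g a d p : R) :
  den_list G g -> den A a -> den_list D d -> p = g * (a * d) ->
  den_list (G ++ [A] ++ D) p.
Proof.
intros Hg Ha Hd ->; apply den_list_middle; exists g, a, d.
repeat split; auto; now apply den_list_singleton.
Qed.

(** Permutation holds by commutativity of the ring, weakening because ideals absorb
    multiplication. *)
Theorem IAL_sound (G : list (formula V)) (C : formula V) :
  derivable (IAL V) G C -> forall p, den_list G p -> den C p.
Proof.
induction 1 as
  [A | P G D A B C _ IHA _ IHC | P A B _ _ IH | P G D A B C _ IHA _ IHC
  | P A B _ _ IH | G D A B C _ IH | G D A B _ IHA _ IHB
  | G D A B C _ IHA _ IHB | P A B _ IH | P A B _ IH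
  | G D A B C _ IH | G D A B C _ IH | P A B _ IHA _ IHB
  | P G D A C _ IHA _ IHC | G D A B C _ _ IH | G D A C _ _ IH | G C []];
  intros p Hp.
- now apply den_list_singleton.
- rewrite app_assoc in Hp; apply den_list_middle in Hp.
  destruct Hp as (gq & f & d & Hgq & Hf & Hd & ->).
  apply den_list_app in Hgq; destruct Hgq as (g & q & Hg & Hq & ->).
  apply den_list_singleton in Hf; simpl in Hf.
  apply IHC, (den_list_middle_singleton G D B g (f * q) d); auto; ring.
- intros a Ha; apply IH, den_list_app; exists a, p.
  repeat split; auto; [now apply den_list_singleton|ring].
- apply den_list_middle in Hp.
  destruct Hp as (g & f & qd & Hg & Hf & Hqd & ->).
  apply den_list_app in Hqd; destruct Hqd as (q & d & Hq & Hd & ->).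
  apply den_list_singleton in Hf; simpl in Hf.
  apply IHC, (den_list_middle_singleton G D B g (f * q) d); auto; ring.
- intros a Ha; apply IH, den_list_app; exists p, a.
  repeat split; auto; now apply den_list_singleton.
- apply den_list_middle in Hp; destruct Hp as (g & r & d & Hg & Hr & Hd & ->).
  apply den_list_singleton in Hr.
  destruct (den_ideal C) as (C0 & Cadd & Cmul).
  (* The elements [r] with [g * (r * d)] in [den C] form an ideal; containing all products [a * b],
     it contains the whole ideal product. *)
  apply (Hr (fun r => den C (g * (r * d)))).
  + split; [|split].
    * now replace (g * (zero * d)) with zero by ring.
    * intros a b Ha Hb.
      replace (g * ((a + b) * d)) with (g * (a * d) + g * (b * d)) by ring; auto.
    * intros c a Ha.
      replace (g * (c * a * d)) with (c * (g * (a * d))) by ring; auto.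
  + intros a b Ha Hb; apply IH, den_list_middle; exists g, (a * b), d.
    repeat split; auto; exists a, b; repeat split; auto.
    now apply den_list_singleton.
- apply den_list_app in Hp; destruct Hp as (g & d & Hg & Hd & ->).
  intros J _ HJ; auto.
- apply den_list_middle in Hp; destruct Hp as (g & r & d & Hg & Hr & Hd & ->).
  apply den_list_singleton in Hr; destruct Hr as (a & b & Ha & Hb & ->).
  replace (g * ((a + b) * d)) with (g * (a * d) + g * (b * d)) by ring.
  apply den_ideal.
  + apply IHA; now apply (den_list_middle_singleton G D A g a d).
  + apply IHB; now apply (den_list_middle_singleton G D B g b d).
- exists p, zero; repeat split; [auto|apply den_ideal|ring].
- exists zero, p; repeat split; [apply den_ideal|auto|ring].
- apply den_list_middle in Hp; destruct Hp as (g & r & d & Hg & Hr & Hd & ->).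
  apply den_list_singleton in Hr; destruct Hr as [Ha _].
  apply IH; now apply (den_list_middle_singleton G D A g r d).
- apply den_list_middle in Hp; destruct Hp as (g & r & d & Hg & Hr & Hd & ->).
  apply den_list_singleton in Hr; destruct Hr as [_ Hb].
  apply IH; now apply (den_list_middle_singleton G D B g r d).
- split; auto.
- apply den_list_middle in Hp; destruct Hp as (g & q & d & Hg & Hq & Hd & ->).
  apply IHC; now apply (den_list_middle_singleton G D A g q d); auto.
- apply den_list_middle in Hp; destruct Hp as (g & q & d & Hg & Hq & Hd & ->).
  destruct Hq as (a & q' & Ha & Hq' & ->); apply den_list_singleton in Hq'.
  apply IH, den_list_middle; exists g, (q' * a), d; repeat split; auto; [|ring].
  exists q', a; repeat split; auto; now apply den_list_singleton.
- apply den_list_middle in Hp; destruct Hp as (g & a & d & Hg & _ & Hd & ->).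
  replace (g * (a * d)) with (a * (g * d)) by ring.
  apply den_ideal, IH, den_list_app; now exists g, d.
Qed.

End IdealSemantics.

(** * The countermodel in [Z[s] / (s^2 - 2 s)] *)

Section Countermodel.

Local Open Scope Z_scope.

(* The pair [(m, n)] stands for [m + n s] in [Z[s] / (s^2 - 2 s)]. *)
Definition zs_add (p q : Z * Z) : Z * Z := (fst p + fst q, snd p + snd q).
Definition zs_opp (p : Z * Z) : Z * Z := (- fst p, - snd p).
Definition zs_sub (p q : Z * Z) : Z * Z := (fst p - fst q, snd p - snd q).
Definition zs_mul (p q : Z * Z) : Z * Z :=
  (fst p * fst q, fst p * snd q + snd p * fst q + 2 * snd p * snd q).

Lemma zs_ring :
  ring_theory (0, 0) (1, 0) zs_add zs_mul zs_sub zs_opp eq.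
Proof.
split; intros; repeat match goal with p : (Z * Z)%type |- _ => destruct p end;
  unfold zs_add, zs_mul, zs_sub, zs_opp; cbn [fst snd]; f_equal; ring.
Qed.

Variables (V : Type) (x y z w : V).
Hypotheses (hxy : x <> y) (hxz : x <> z) (hxw : x <> w)
  (hyz : y <> z) (hyw : y <> w) (hzw : z <> w).

(* Equality on [V] need not be decidable, so the value at [u] is defined as the
   intersection of the ideals prescribed for the variables equal to [u]. *)
Definition zs_val (u : V) (p : Z * Z) : Prop :=
  (u = x -> p = (0, 0)) /\
  (u = y -> fst p + 2 * snd p = 0) /\
  (u = z -> fst p = 0) /\
  (u = w -> (2 | fst p) /\ (2 | snd p)).

Lemma zs_val_ideal (u : V) : is_ideal _ (0, 0) zs_add zs_mul (zs_val u).
Proof.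
unfold zs_val, zs_add, zs_mul; split; [|split].
- repeat split; auto using Z.divide_0_r.
- intros [m n] [m' n'] (Hx & Hy & Hz & Hw) (Hx' & Hy' & Hz' & Hw').
  cbn [fst snd] in *.
  split; [|split; [|split]]; intros E; [| | |split].
  + specialize (Hx E); specialize (Hx' E).
    now injection Hx as -> ->; injection Hx' as -> ->.
  + specialize (Hy E); specialize (Hy' E); lia.
  + specialize (Hz E); specialize (Hz' E); lia.
  + apply Z.divide_add_r; [apply (Hw E)|apply (Hw' E)].
  + apply Z.divide_add_r; [apply (Hw E)|apply (Hw' E)].
- intros [c d] [m n] (Hx & Hy & Hz & Hw); cbn [fst snd] in *.
  split; [|split; [|split]]; intros E; [| | |split].
  + specialize (Hx E); injection Hx as -> ->; f_equal; ring.
  + specialize (Hy E); replace m with (- 2 * n) by lia; ring.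
  + specialize (Hz E); subst m; ring.
  + destruct (Hw E) as [[k ->] _]; exists (c * k); ring.
  + destruct (Hw E) as [[k ->] [l ->]]; exists (c * l + d * k + 2 * d * l); ring.
Qed.

Local Notation zs_den := (den _ (0, 0) zs_add zs_mul _ zs_val).

(** Distinctness of the variables makes the other three clauses vacuous, here and for [y], [z] and
    [w]. *)
Lemma zs_val_x p : zs_val x p <-> p = (0, 0).
Proof. unfold zs_val; intuition congruence. Qed.

(** This is the kernel of evaluation at [s = 2], generated by [t = 2 - s]; the condition for [z] is
    the kernel of evaluation at [s = 0], generated by [s]. *)
Lemma zs_val_y p : zs_val y p <-> fst p + 2 * snd p = 0.
Proof. unfold zs_val; intuition congruence. Qed.

Lemma zs_val_z p : zs_val z p <-> fst p = 0.
Proof. unfold zs_val; intuition congruence. Qed.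

Lemma zs_val_w p : zs_val w p <-> (2 | fst p) /\ (2 | snd p).
Proof. unfold zs_val; intuition congruence. Qed.

Lemma zs_den_x_over_y p : zs_den (Var x / Var y)%F p <-> fst p = 0.
Proof.
destruct p as [m n]; cbn [den fst snd].
setoid_rewrite zs_val_x; setoid_rewrite zs_val_y.
unfold zs_mul; cbn [fst snd]; split.
(* Dividing the zero ideal gives an annihilator, so it is tested on the generator [t = (2, -1)]. *)
- intros H; specialize (H (2, -1) eq_refl).
  apply (f_equal snd) in H; cbn [fst snd] in H; lia.
- intros -> [a b] E; cbn [fst snd] in *; replace a with (- 2 * b) by lia.
  f_equal; ring.
Qed.

Lemma zs_den_x_over_z p : zs_den (Var x / Var z)%F p <-> fst p + 2 * snd p = 0.
Proof.
destruct p as [m n]; cbn [den fst snd].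
setoid_rewrite zs_val_x; setoid_rewrite zs_val_z.
unfold zs_mul; cbn [fst snd]; split.
(* The generator here is [s = (0, 1)]. *)
- intros H; specialize (H (0, 1) eq_refl).
  apply (f_equal snd) in H; cbn [fst snd] in H; lia.
- intros E [a b] F; cbn [fst snd] in *; subst a; replace m with (- 2 * n) by lia.
  f_equal; ring.
Qed.

Lemma zs_den_x_over_y_join_w p :
  zs_den (Var x / Var y ∨ Var w)%F p <-> (2 | fst p).
Proof.
split.
- intros (a & b & Ha & Hb & ->).
  apply zs_den_x_over_y in Ha; apply zs_val_w in Hb.
  now apply Z.divide_add_r; [rewrite Ha; apply Z.divide_0_r|].
- intros E; exists (0, snd p), (fst p, 0); split; [|split].
  + now apply zs_den_x_over_y.
  + apply zs_val_w; split; [assumption|apply Z.divide_0_r].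
  + destruct p; unfold zs_add; cbn [fst snd] in *; f_equal; lia.
Qed.

(** Since [t = 2 - s], the ideals [(t, 2)] and [(s, 2)] coincide. *)
Lemma zs_den_x_over_z_join_w p :
  zs_den (Var x / Var z ∨ Var w)%F p <-> (2 | fst p).
Proof.
split.
- intros (a & b & Ha & Hb & ->).
  apply zs_den_x_over_z in Ha; apply zs_val_w in Hb.
  destruct Hb as [[k E] _]; exists (k - snd a).
  unfold zs_add; cbn [fst]; lia.
(* With [p = m + n s], the summands are [- n t] and the integer [m + 2 n], which is even when [m]
   is. *)
- intros E; exists (-2 * snd p, snd p), (fst p + 2 * snd p, 0).
  split; [|split].
  + apply zs_den_x_over_z; cbn [fst snd]; lia.
  + apply zs_val_w; split; [|apply Z.divide_0_r].
    apply Z.divide_add_r; [assumption|apply Z.divide_factor_l].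
  + destruct p; unfold zs_add; cbn [fst snd] in *; f_equal; lia.
Qed.

(** An element sending [(t) + (s)] to zero annihilates each summand, hence lies in both [(s)] and
    [(t)]. *)
Lemma zs_den_x_over_join p : zs_den (Var x / (Var y ∨ Var z))%F p -> p = (0, 0).
Proof.
intros H.
assert (Ey : fst p = 0).
{ apply zs_den_x_over_y; intros a Ha; apply H.
  exists a, (0, 0); split; [|split]; [assumption|apply zs_val_ideal|].
  destruct a; unfold zs_add; simpl; f_equal; ring. }
assert (Ez : fst p + 2 * snd p = 0).
{ apply zs_den_x_over_z; intros a Ha; apply H.
  exists (0, 0), a; split; [|split]; [apply zs_val_ideal|assumption|].
  now destruct a. }
destruct p; cbn [fst snd] in *; f_equal; lia.
Qed.

Lemma IAL_not_derivable :
  ~ derivable (IAL V)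
    [(Var x / Var y ∨ Var w) / (Var x / Var y ∨ Var x / Var z ∨ Var w);
     Var x / Var y ∨ Var w;
     (Var x / Var y ∨ Var w) \ (Var x / Var z ∨ Var w)]%F
    (Var x / (Var y ∨ Var z) ∨ Var w)%F.
Proof.
intros Hder.
assert (H : zs_den (Var x / (Var y ∨ Var z) ∨ Var w)%F (0, 1)).
{ apply (IAL_sound _ _ _ _ _ _ _ zs_ring _ _ zs_val_ideal _ _ Hder).
  (* The element [s] is factored as [1 * (s * (1 * 1))], the last unit standing for the empty list.
     The unit lies in each division because the numerator contains the denominator. *)
  exists (1, 0), (0, 1); split; [|split; [|reflexivity]].
  - intros r (ab & c & (a & b & Ha & Hb & ->) & Hc & ->).
    apply zs_den_x_over_y in Ha; apply zs_den_x_over_z in Hb.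
    apply zs_val_w in Hc; destruct Hc as [[k E] _].
    apply zs_den_x_over_y_join_w; exists (k - snd b).
    unfold zs_add, zs_mul; cbn [fst snd]; lia.
  - exists (0, 1), (1, 0); split; [|split; [|reflexivity]].
    + apply zs_den_x_over_y_join_w, Z.divide_0_r.
    + exists (1, 0), (1, 0); repeat split; intros r Hr.
      apply zs_den_x_over_y_join_w in Hr; apply zs_den_x_over_z_join_w.
      destruct Hr as [k E]; exists k.
      unfold zs_mul; cbn [fst snd]; lia. }
destruct H as (a & b & Ha & Hb & E).
apply zs_den_x_over_join in Ha; apply zs_val_w in Hb; subst a.
(* The coefficient of [s] in [s] itself is 1, which would have to be even. *)
destruct Hb as [_ [l El]]; apply (f_equal snd) in E.
unfold zs_add in E; cbn [fst snd] in E; lia.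
Qed.

End Countermodel.

Theorem theorem7 (V : Type) (x y z w : V)
    (hxy : x <> y) (hxz : x <> z) (hxw : x <> w)
    (hyz : y <> z) (hyw : y <> w) (hzw : z <> w) :
  let X := Var x in
  let Y := Var y in
  let Z := Var z in
  let W := Var w in
  let antecedent :=
    [ (X / Y ∨ W) / (X / Y ∨ X / Z ∨ W);
      X / Y ∨ W;
      (X / Y ∨ W) \ (X / Z ∨ W) ]%F in
  let succedent := (X / (Y ∨ Z) ∨ W)%F in
  derivable (MALC_D V) antecedent succedent /\
  ~ derivable (IAL V) antecedent succedent.
Proof.
simpl; split.
- eapply (@d_cut _ (MALC_D V) [_; _; _] [] []); [apply guarded_distributivity|].
  apply join_monotone_left, over_meet_over_join.
- now apply IAL_not_derivable.
Qed.
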